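(* Let $-\infty<a\le b<+\infty$ and let $f\in E$. (i) Let $x_0\in[a,b]$ and suppose that $$\int_0^h|\phi_{x_0}(t)|\,dt=o(h)\quad\text{as } h\to 0^+,\qquad \int_0^h|\phi_{x_0}(t)|\,dt=o(h)\quad\text{as } h\to+\infty, \tag{A}$$ and that, with $\eta=\frac{l}{n}$, $$\int_{\eta}^{l}\frac{|\phi_{x_0}(t)-\phi_{x_0}(t+\eta)|}{t}\,dt\longrightarrow 0\quad\text{as } n\to+\infty,\ l\to+\infty,\ \eta=\frac{l}{n}\to 0. \tag{B}$$ Then $$S_n^l(x_0;f)\longrightarrow f(x_0)\quad\text{as } n\to+\infty,\ l\to+\infty,\ \eta=\frac{l}{n}\to 0.$$ (ii) Suppose in addition that $f$ is bounded on $[a,b]$ and that the conditions (A) and (B) hold uniformly for $x_0\in[a,b]$. Then $S_n^l(x;f)\to f(x)$ uniformly for $x\in[a,b]$ as $n\to+\infty$, $l\to+\infty$, $\frac{l}{n}\to0$.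
   Context: $E$ is the class of all real-valued, locally Lebesgue integrable functions $f$ on $\mathbb{R}$ such that, for every fixed $c>0$, $$\lim_{T\to\infty}\frac1T\int_T^{T+c}|f(t)|\,dt=0,\qquad \lim_{T\to\infty}\frac1T\int_{-T-c}^{-T}|f(t)|\,dt=0.$$ For $f\in E$, a real number $l>0$ and an integer $k\ge 0$, put $$a_k^l=\frac1l\int_{-l}^{l}f(t)\cos\frac{\pi kt}{l}\,dt,\qquad b_k^l=\frac1l\int_{-l}^{l}f(t)\sin\frac{\pi kt}{l}\,dt,$$ and for $x\in\mathbb{R}$ and an integer $n\ge0$ put $$S_n^l(x;f)=\frac{a_0^l}{2}+\sum_{k=1}^{n}\left(a_k^l\cos\frac{\pi kx}{l}+b_k^l\sin\frac{\pi kx}{l}\right).$$ For $x,t\in\mathbb{R}$ put $\phi_x(t)=f(x+t)+f(x-t)-2f(x)$. Convention on limits: a quantity $Q(n,l)$, depending on a positive integer $n$ and a real $l>0$, tends to $q$ as $n\to+\infty$, $l\to+\infty$, $\frac{l}{n}\to0$ if for every $\varepsilon>0$ there exist $N>0$ and $\delta>0$ such that $|Q(n,l)-q|<\varepsilon$ for all positive integers $n\ge N$ and all real $l\ge N$ with $\frac{l}{n}\le\delta$. Uniformity in $x_0\in[a,b]$ (or $x\in[a,b]$) means that the thresholds in the limits can be chosen independently of that point. *)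

(* Defs.v *)
From HB Require Import structures.
From mathcomp Require Import all_boot all_order all_algebra.
From mathcomp Require Import all_classical all_reals all_analysis.
Import Order.TTheory GRing.Theory Num.Theory.
Import numFieldNormedType.Exports.

Set Implicit Arguments.
Unset Strict Implicit.
Unset Printing Implicit Defensive.

Local Open Scope classical_set_scope.
Local Open Scope ring_scope.

Section Definitions.
Context {R : realType}.
Implicit Types (f g : R -> R) (u v x t l c : R) (n k : nat).

(* [lebesgue_measure] lives on the Borel sigma-algebra.  Its completion is used
   throughout, so that [measurable] means Lebesgue measurable. *)
Local Notation mu := (@completed_lebesgue_measure R).

(* When [locally_lebesgue_integrable f] and n, l > 0, every [g] below is
   integrable on [u, v], so the default value of [Rintegral] never arises. *)
Definition lint u v g : R := \int[mu]_(t in `[u, v]) g t.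

Definition locally_lebesgue_integrable f : Prop :=
  forall K : set R, compact K -> mu.-integrable K (EFin \o f).

Definition classE f : Prop :=
  [/\ locally_lebesgue_integrable f,
      forall c, 0 < c ->
        T^-1 * lint T (T + c) (fun t => `|f t|) @[T --> +oo] --> (0 : R)
    & forall c, 0 < c ->
        T^-1 * lint (- T - c) (- T) (fun t => `|f t|) @[T --> +oo] --> (0 : R)].

Definition coef_a f l k : R :=
  l^-1 * lint (- l) l (fun t => f t * cos (pi * k%:R * t / l)).

Definition coef_b f l k : R :=
  l^-1 * lint (- l) l (fun t => f t * sin (pi * k%:R * t / l)).

Definition partial_sum f n l x : R :=
  coef_a f l 0 / 2 +
  \sum_(1 <= k < n.+1) (coef_a f l k * cos (pi * k%:R * x / l) +
                        coef_b f l k * sin (pi * k%:R * x / l)).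

Definition phi f x t : R := f (x + t) + f (x - t) - 2 * f x.

(* Limits as n -> +oo, l -> +oo, l / n -> 0. *)
Definition cvg_nl (Q : nat -> R -> R) (q : R) : Prop :=
  forall eps : R, 0 < eps -> exists N delta : R, [/\ 0 < N, 0 < delta &
    forall n l, (0 < n)%N -> N <= n%:R -> N <= l -> l / n%:R <= delta ->
      `|Q n l - q| < eps].

Definition unif_cvg_nl (X : set R) (Q : R -> nat -> R -> R) (q : R -> R) : Prop :=
  forall eps : R, 0 < eps -> exists N delta : R, [/\ 0 < N, 0 < delta &
    forall x n l, X x ->
      (0 < n)%N -> N <= n%:R -> N <= l -> l / n%:R <= delta ->
      `|Q x n l - q x| < eps].

Definition int_phi f x (h : R) : R := lint 0 h (fun t => `|phi f x t|).

Definition int_dphi f x n l : R :=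
  let eta := l / n%:R in
  lint eta l (fun t => `|phi f x t - phi f x (t + eta)| / t).

(* [g h = o(h)] along the filter [F]; the definition underlying [g =o_F id] in
   the library, whose notation does not accept the filter [+oo]. *)
Definition little_o (F : set_system R) (g : R -> R) : Prop :=
  forall eps : R, 0 < eps -> \forall h \near F, `|g h| <= eps * `|h|.

Definition unif_little_o (X : set R) (F : set_system R) (g : R -> R -> R) : Prop :=
  forall eps : R, 0 < eps ->
    \forall h \near F, forall x, X x -> `|g x h| <= eps * `|h|.

Definition condA f x : Prop :=
  little_o 0^'+ (int_phi f x) /\ little_o +oo (int_phi f x).

Definition unif_condA (X : set R) f : Prop :=
  unif_little_o X 0^'+ (int_phi f) /\ unif_little_o X +oo (int_phi f).

Definition condB f x : Prop := cvg_nl (int_dphi f x) 0.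

Definition unif_condB (X : set R) f : Prop :=
  unif_cvg_nl X (int_dphi f) (fun=> 0).

End Definitions.

(* Main.v *)
Require Import Defs.
From mathcomp Require Import all_boot all_order all_algebra.
From mathcomp Require Import all_classical all_reals all_analysis measurable_realfun.
From mathcomp Require Import ring lra.
Import Order.TTheory GRing.Theory Num.Theory.
Import numFieldNormedType.Exports.

Local Open Scope classical_set_scope.
Local Open Scope ring_scope.

(* With [D_n] the Dirichlet kernel, [S_n^l(x) - f(x)] is
   [1/l \int_{-l}^{l} (f(t) - f(x)) D_n(pi (t - x) / l) dt].  Moving the window
   to [x - l, x + l] costs two integrals over bounded intervals near [l] and
   [-l], where the kernel is at most [1]; these are [o(l)] since [f] is in [E].
   What remains is [1/l \int_0^l phi(t) D_n(pi t / l) dt], which up to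
   [1/l \int_0^l |phi|] and [2/eta \int_0^eta |phi|] is
   [J / pi] for [J = \int_eta^l phi(t) sin(pi t / eta) / t dt].  The sine changes
   sign under [t |-> t + eta], so averaging [J] with its translate bounds it by
   the integral of condition (B), two boundary terms and
   [eta \int_{2 eta}^{l + eta} |phi(t)| / t^2 dt].  The last one is small by (A),
   on splitting the range dyadically. *)

(** * Completed Lebesgue measure, and integration over segments against it *)

Section CompletedLebesgue.
Context {R : realType}.
Local Notation mu := (@completed_lebesgue_measure R).
Local Notation leb := (@lebesgue_measure R).
Local Notation cR := (caratheodory_type (wlength idfun)^*%mu).

Lemma completed_measurable (A : set R) :
  measurable A -> measurable (A : set cR).
Proof. exact: sub_caratheodory. Qed.

Lemma completed_measurable_fun (D : set R) (h : R -> R) :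
  measurable D -> measurable_fun D h -> measurable_fun (D : set cR) h.
Proof.
by move=> mD mh _ B mB; apply: completed_measurable; exact: mh.
Qed.

Lemma completed_lebesgueE (A : set R) : mu A = leb A.
Proof. by []. Qed.

(** The Caratheodory sets are the completion of the Borel sets. The sandwich form between [B] and
    [B] enlarged by a Borel null set is chosen because it passes to preimages. *)
Lemma completed_measurableP (A : set R) :
  measurable (A : set cR) <->
  exists B Z : set R, [/\ measurable B, measurable Z, leb Z = 0%E,
    B `<=` A & A `<=` B `|` Z].
Proof.
have -> : measurable (A : set cR) = completed_algebra_gen leb A.
  by rewrite -g_sigma_completed_algebra_genE completed_caratheodory_measurable.
split=> [[B mB [N [Z [mZ Z0 NZ]] <-]]|[B [Z [mB mZ Z0 BA ABZ]]]].
  exists B, Z; split => //; exact: setUS.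
exists B => //; exists (A `\` B).
  exists Z; split => // x [/ABZ[]//].
exact: setDUK.
Qed.

Section MeasurePreserving.
Variable s : R -> R.
Hypothesis ms : measurable_fun setT s.
Hypothesis leb_s : forall A : set R, measurable A -> leb (s @^-1` A) = leb A.

Let ms' (A : set R) : measurable A -> measurable (s @^-1` A).
Proof. by move=> mA; rewrite -[_ @^-1` _]setTI; exact: ms. Qed.

(** Borel measurability of [s] alone does not pull back completed sets; here it does because [s]
    maps no non-null set into a null one, so both sides of the sandwich pull back. *)
Lemma completed_measurable_preimage :
  measurable_fun (setT : set cR) (s : cR -> cR).
Proof.
move=> _ A /completed_measurableP[B [Z [mB mZ Z0 BA ABZ]]]; rewrite setTI.
apply/completed_measurableP; exists (s @^-1` B), (s @^-1` Z).
by split; [exact: ms'|exact: ms'|rewrite leb_s|move=> x /BA|move=> x /ABZ].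
Qed.

Lemma completed_measure_preimage (A : set R) : measurable (A : set cR) ->
  mu (s @^-1` A) = mu A.
Proof.
move=> mA; have /completed_measurableP[B [Z [mB mZ Z0 BA ABZ]]] := mA.
(* A set sandwiched between a Borel set and its enlargement by a null set has the measure of that
   Borel set. This applies to [A] and to its preimage. *)
have key (C D E : set R) : measurable C -> measurable E -> leb E = 0%E ->
    measurable (D : set cR) -> C `<=` D -> D `<=` C `|` E -> mu D = leb C.
  move=> mC mE E0 mD CD DCE; apply/eqP; rewrite eq_le; apply/andP; split.
    apply: (@le_trans _ _ (leb (C `|` E))).
      by apply: le_measure; rewrite ?inE//; apply: completed_measurable;
        exact: measurableU.
    by rewrite measureU0.
  by apply: (@le_measure _ _ _ mu); rewrite ?inE//; exact: completed_measurable.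
rewrite (key B A Z)// (key (s @^-1` B) (s @^-1` A) (s @^-1` Z)) ?leb_s//.
- exact: ms'.
- exact: ms'.
- by rewrite -[_ @^-1` _]setTI; exact: completed_measurable_preimage.
- by move=> x /BA.
- by move=> x /ABZ.
Qed.

(** Change of variables for the pushforward of [mu] along [s], which is [mu] itself. *)
Let ge0_integral_preimage (D : set R) (g : cR -> \bar R) :
  measurable (D : set cR) -> measurable_fun (D : set cR) g ->
  (forall x, 0 <= g x)%E ->
  (\int[mu]_(t in s @^-1` D) (g \o s) t = \int[mu]_(t in D) g t)%E.
Proof.
move=> mD mg g0.
have ms2 := completed_measurable_preimage.
have := @ge0_integral_pushforward _ _ cR cR R s ms2 mu D g mD mg (fun x _ => g0 x).
move=> <-; apply: eq_measure_integral => A mA _.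
exact: completed_measure_preimage.
Qed.

Lemma integrable_preimage (D : set R) (g : R -> R) : measurable (D : set cR) ->
  mu.-integrable D (EFin \o g) ->
  mu.-integrable (s @^-1` D) (EFin \o (g \o s)).
Proof.
move=> mD /integrableP[mg gfin]; apply/integrableP; split.
  apply: (measurable_comp mD _ mg); first by move=> _ [t + <-].
  by apply: measurable_funTS; exact: completed_measurable_preimage.
rewrite (@ge0_integral_preimage D (abse \o (EFin \o g)))//.
- exact: measurableT_comp.
- by move=> x; exact: abse_ge0.
Qed.

Lemma Rintegral_preimage (D : set R) (g : R -> R) : measurable (D : set cR) ->
  mu.-integrable D (EFin \o g) ->
  \int[mu]_(t in s @^-1` D) g (s t) = \int[mu]_(t in D) g t.
Proof.
move=> mD /integrableP[mg gfin]; congr fine.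
rewrite integralE [in RHS]integralE.
rewrite -(ge0_integral_preimage D (funepos (EFin \o g)))//; last exact: measurable_funepos.
rewrite -(ge0_integral_preimage D (funeneg (EFin \o g)))//; last exact: measurable_funeneg.
by rewrite -funepos_comp -funeneg_comp.
Qed.

End MeasurePreserving.

(** The pushforward under translation gives half-open intervals their length, so it is Lebesgue
    measure by uniqueness. *)
Lemma lebesgue_measure_shift (c : R) (A : set R) : measurable A ->
  leb ((fun t => t + c) @^-1` A) = leb A.
Proof.
move=> mA; have ms : measurable_fun setT (fun t : R => t + c) by exact: measurable_funD.
pose s : R -> measurableTypeR R := fun t : measurableTypeR R => t + c.
rewrite -[LHS]/(pushforward leb s A).
apply/esym/lebesgue_measure_unique => //= _ [[a b]] _ <-.
rewrite /pushforward.
have -> : s @^-1` `]a, b] = `]a - c, b - c]%classic.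
  by apply/seteqP; split => x /=; rewrite !in_itv/= ltrBlDr lerBrDr.
by rewrite !lebesgue_measure_itv/= !lte_fin ltrD2r -!EFinB opprD addrACA subrr addr0.
Qed.

(** For [v < u] the segment is empty and this holds trivially, so the rules below carry no ordering
    of the endpoints. *)
Definition seg_integrable (u v : R) (g : R -> R) :=
  mu.-integrable `[u, v] (EFin \o g).

Lemma measurable_seg (u v : R) : measurable (`[u, v]%classic : set cR).
Proof. by apply: completed_measurable; exact: measurable_itv. Qed.

Lemma shift_preimage (c u v : R) :
  (fun t => t + c) @^-1` `[u + c, v + c]%classic = `[u, v]%classic.
Proof. by apply/seteqP; split => x /=; rewrite !in_itv/= !lerD2r. Qed.

Lemma seg_integrable_shift (c u v : R) (g : R -> R) :
  seg_integrable (u + c) (v + c) g -> seg_integrable u v (fun t => g (t + c)).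
Proof.
move=> ig; rewrite /seg_integrable -(shift_preimage c).
apply: (integrable_preimage (fun t => t + c)) => //.
- exact: measurable_funD.
- exact: lebesgue_measure_shift.
- exact: measurable_seg.
Qed.

Lemma lint_shift (c u v : R) (g : R -> R) : seg_integrable (u + c) (v + c) g ->
  lint u v (fun t => g (t + c)) = lint (u + c) (v + c) g.
Proof.
move=> ig; rewrite /lint -(shift_preimage c).
apply: (Rintegral_preimage (fun t => t + c)) => //.
- exact: measurable_funD.
- exact: lebesgue_measure_shift.
- exact: measurable_seg.
Qed.

Lemma opp_preimage (u v : R) : -%R @^-1` `[- v, - u]%classic = `[u, v]%classic.
Proof. by apply/seteqP; split => x /=; rewrite !in_itv/= !lerN2 andbC. Qed.

Lemma seg_integrable_opp (u v : R) (g : R -> R) :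
  seg_integrable (- v) (- u) g -> seg_integrable u v (fun t => g (- t)).
Proof.
move=> ig; rewrite /seg_integrable -opp_preimage.
apply: (integrable_preimage (-%R)) => //.
- exact: lebesgue_measureN.
- exact: measurable_seg.
Qed.

Lemma lint_opp (u v : R) (g : R -> R) : seg_integrable (- v) (- u) g ->
  lint u v (fun t => g (- t)) = lint (- v) (- u) g.
Proof.
move=> ig; rewrite /lint -opp_preimage.
apply: (Rintegral_preimage (-%R)) => //.
- exact: lebesgue_measureN.
- exact: measurable_seg.
Qed.

(** * Rules for integrability and integrals on segments *)

Lemma seg_integrableS (u v u' v' : R) (g : R -> R) : u' <= u -> v <= v' ->
  seg_integrable u' v' g -> seg_integrable u v g.
Proof.
move=> uu vv; apply: integrableS; [exact: measurable_seg|exact: measurable_seg|].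
by apply: subset_itv; rewrite bnd_simp.
Qed.

Lemma seg_integrableD (u v : R) (g h : R -> R) :
  seg_integrable u v g -> seg_integrable u v h ->
  seg_integrable u v (fun t => g t + h t).
Proof.
by move=> ig ih; apply: (integrableD _ ig ih); exact: measurable_seg.
Qed.

Lemma seg_integrable_norm (u v : R) (g : R -> R) :
  seg_integrable u v g -> seg_integrable u v (fun t => `|g t|).
Proof. exact: integrable_norm. Qed.

Lemma mu_seg (u v : R) : u <= v -> mu `[u, v]%classic = (v - u)%:E.
Proof.
rewrite le_eqVlt completed_lebesgueE lebesgue_measure_itv/= lte_fin.
by case: (ltgtP u v) => //= -> _; rewrite subrr.
Qed.

Lemma seg_integrable_cst (u v r : R) : seg_integrable u v (fun=> r).
Proof.
apply: measurable_bounded_integrable; first exact: measurable_seg.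
- suff : (leb `[u, v]%classic < +oo)%E by [].
  rewrite lebesgue_measure_itv/=.
  by case: ifPn => // _; rewrite -EFinB ltry.
- exact: measurable_cst.
- exact: bounded_cst.
Qed.

Lemma seg_integrableM (u v C : R) (g h : R -> R) : seg_integrable u v g ->
  measurable_fun `[u, v] h -> (forall t, u <= t <= v -> `|h t| <= C) ->
  seg_integrable u v (fun t => g t * h t).
Proof.
move=> ig mh hC.
apply: (@integrableMl _ _ _ mu _ (measurable_seg u v) (EFin \o g) h ig).
- exact: completed_measurable_fun.
- exists C; split; first exact: num_real.
  by move=> M CM t /= /[!in_itv]/= /hC /le_trans; apply; exact: ltW.
Qed.

Lemma eq_lint (u v : R) (g h : R -> R) :
  (forall t, u <= t <= v -> g t = h t) -> lint u v g = lint u v h.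
Proof.
by move=> gh; apply: eq_Rintegral => t; rewrite inE/= in_itv/= => /gh.
Qed.

Lemma lintD (u v : R) (g h : R -> R) :
  seg_integrable u v g -> seg_integrable u v h ->
  lint u v (fun t => g t + h t) = lint u v g + lint u v h.
Proof. by move=> ig ih; apply: RintegralD => //; exact: measurable_seg. Qed.

Lemma lintZl (u v r : R) (g : R -> R) : seg_integrable u v g ->
  lint u v (fun t => r * g t) = r * lint u v g.
Proof. by move=> ig; apply: RintegralZl => //; exact: measurable_seg. Qed.

Lemma seg_integrableZl (u v r : R) (g : R -> R) : seg_integrable u v g ->
  seg_integrable u v (fun t => r * g t).
Proof.
move=> ig; have : seg_integrable u v (fun t => g t * r).
  by apply: (seg_integrableM _ _ `|r|).
by under [X in seg_integrable u v X]eq_fun do rewrite mulrC.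
Qed.

Lemma seg_integrableB (u v : R) (g h : R -> R) :
  seg_integrable u v g -> seg_integrable u v h ->
  seg_integrable u v (fun t => g t - h t).
Proof.
by move=> ig ih; apply: (integrableB _ ig ih); exact: measurable_seg.
Qed.

Lemma lintB (u v : R) (g h : R -> R) :
  seg_integrable u v g -> seg_integrable u v h ->
  lint u v (fun t => g t - h t) = lint u v g - lint u v h.
Proof. by move=> ig ih; apply: RintegralB => //; exact: measurable_seg. Qed.

Lemma lint_cst (u v r : R) : u <= v -> lint u v (fun=> r) = r * (v - u).
Proof.
move=> uv; rewrite /lint Rintegral_cst; last exact: measurable_seg.
congr (_ * _); transitivity (fine (mu `[u, v]%classic)) => //.
by rewrite mu_seg.
Qed.

Lemma le_lint (u v : R) (g h : R -> R) :
  seg_integrable u v g -> seg_integrable u v h ->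
  (forall t, u <= t <= v -> g t <= h t) -> lint u v g <= lint u v h.
Proof.
move=> ig ih gh; apply: le_Rintegral => //. exact: measurable_seg.
Qed.

Lemma lint_ge0 (u v : R) (g : R -> R) :
  (forall t, u <= t <= v -> 0 <= g t) -> 0 <= lint u v g.
Proof. by move=> g0; apply: Rintegral_ge0 => t /=; rewrite in_itv/=; exact: g0. Qed.

Lemma lint_split (u v w : R) (g : R -> R) : u <= v -> v <= w ->
  seg_integrable u w g -> lint u w g = lint u v g + lint v w g.
Proof.
move=> uv vw ig.
have mvw : measurable (`]v, w]%classic : set cR).
  by apply: completed_measurable; exact: measurable_itv.
have m1 : measurable ([set v] : set cR) by apply: completed_measurable; exact: measurable_set1.
have E : `[u, w]%classic = `[u, v]%classic `|` `]v, w]%classic.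
  by rewrite -itv_bndbnd_setU// bnd_simp.
rewrite {1}/lint E Rintegral_setU//.
- congr (_ + _); rewrite /lint /Rintegral.
  (* The closed segments share the endpoint [v]; removing this null point from the second one makes
     the union disjoint. *)
  rewrite [in RHS](@negligible_integral _ _ _ mu _ [set v])//.
  + by rewrite setDitv1l.
  + exact: measurable_seg.
  + by apply: (seg_integrableS v w u w).
  + exact: lebesgue_measure_set1.
- exact: measurable_seg.
- by rewrite -E.
- by apply/disj_setPS => x [/=]; rewrite !in_itv/= => /andP[_ xv] /andP[]; rewrite ltNge xv.
Qed.

Lemma ler_norm_lint (u v : R) (g h : R -> R) : seg_integrable u v g ->
  seg_integrable u v h -> (forall t, u <= t <= v -> `|g t| <= h t) ->
  `|lint u v g| <= lint u v h.
Proof.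
move=> ig ih gh; apply: (le_trans (le_normr_Rintegral (measurable_seg u v) ig)).
by apply: le_lint => //; exact: seg_integrable_norm.
Qed.

End CompletedLebesgue.

(** * The Dirichlet kernel: closed form and bounds *)

Section DirichletKernel.
Context {R : realType}.
Implicit Types (u x y t : R) (n k : nat).

(** The constant term is 1/2, matching the halved coefficient of order 0 in [partial_sum]. *)
Definition dirichlet n u : R := 2^-1 + \sum_(1 <= k < n.+1) cos (k%:R * u).

Lemma dirichletS n u : dirichlet n.+1 u = dirichlet n u + cos (n.+1%:R * u).
Proof. by rewrite /dirichlet big_nat_recr//= addrA. Qed.

(** The sum telescopes, since 2 cos(k u) sin(u/2) = sin(k u + u/2) - sin(k u - u/2). The product
    form stays valid where sin(u/2) vanishes. *)
Lemma dirichlet_sin n u :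
  dirichlet n u * (2 * sin (u / 2)) = sin (n%:R * u + u / 2).
Proof.
elim: n => [|n IH].
  by rewrite /dirichlet big_geq// addr0 mul0r add0r mulrA mulVf ?mul1r.
rewrite dirichletS mulrDl IH.
have -> : n%:R * u + u / 2 = n.+1%:R * u - u / 2.
  by rewrite -(natr1 n) mulrDl mul1r; field.
by rewrite sinB sinD; ring.
Qed.

Lemma dirichletN n u : dirichlet n (- u) = dirichlet n u.
Proof.
by congr (_ + _); apply: eq_bigr => k _; rewrite mulrN cosN.
Qed.

Lemma norm_dirichlet_le n u : `|dirichlet n u| <= 2^-1 + n%:R.
Proof.
elim: n => [|n IH].
  by rewrite /dirichlet big_geq// !addr0 ger0_norm.
rewrite dirichletS -natr1 addrA; apply: (le_trans (ler_normD _ _)).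
by apply: lerD => //; exact: cos_max.
Qed.

Lemma continuous_dirichlet n : continuous (dirichlet n).
Proof.
elim: n => [|n IH].
  rewrite (_ : dirichlet 0 = cst 2^-1); first by move=> u; exact: cvg_cst.
  by apply/funext => u; rewrite /dirichlet big_geq// addr0.
rewrite (_ : dirichlet n.+1 = fun u => dirichlet n u + cos (n.+1%:R * u)); last first.
  by apply/funext => u; rewrite dirichletS.
move=> u; apply: cvgD; first exact: IH.
apply: (@continuous_comp _ _ _ (fun u => n.+1%:R * u) cos); last exact: continuous_cos.
exact: mulrl_continuous.
Qed.

(** In this range cos u <= 0, hence sin(u/2)^2 >= 1/2, and squaring [dirichlet_sin] bounds the
    square of the kernel by 1/2. *)
Lemma norm_dirichlet_le1 n u : pi / 2 <= `|u| <= pi + pi / 2 -> `|dirichlet n u| <= 1.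
Proof.
move=> /andP[u1 u2].
have cu : cos u <= 0.
  rewrite -cos_norm -oppr_ge0 -[leRHS]opprK -cosDpi.
  rewrite opprK -[cos _](_ : cos (`|u| - pi) = _); last first.
    by rewrite -[`|u| + pi](_ : `|u| - pi + pi *+ 2 = _) ?cosD2pi// mulr2n; ring.
  by apply: cos_ge0_pihalf; lra.
have s2 : 2^-1 <= sin (u / 2) ^+ 2.
  have : cos u = cos (u / 2 *+ 2) by rewrite -mulr_natr divfK.
  by rewrite cos_mulr2n cos2sin2 => E; rewrite E in cu; lra.
have := dirichlet_sin n u => /(congr1 (fun z => z ^+ 2)); rewrite !exprMn => E.
have : sin (n%:R * u + u / 2) ^+ 2 <= 1.
  by rewrite -real_normK ?num_real// expr_le1// sin_max.
rewrite -E => D1; rewrite -(@expr_le1 _ 2)// real_normK ?num_real//.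
have := sqr_ge0 (dirichlet n u); nra.
Qed.

Lemma sin_MVT y : 0 <= y -> exists2 c, 0 <= c <= y & sin y = cos c * y.
Proof.
move=> y0; have [c cy] := MVT_segment (f := sin) (df := cos) y0 (fun x _ => is_derive_sin x)
  (continuous_subspaceT (@continuous_sin R)).
by rewrite sin0 !subr0; exists c.
Qed.

Lemma sin_le_id y : 0 <= y -> sin y <= y.
Proof.
by move=> y0; have [c _ ->] := sin_MVT y y0; rewrite ler_piMl// cos_le1.
Qed.

(** The mean value c lies in [0, y], and cosine decreases on [0, pi], so cos y <= cos c. *)
Lemma mul_cos_le_sin y : 0 <= y <= pi -> y * cos y <= sin y.
Proof.
move=> /andP[y0 ypi]; have [c /andP[c0 cy] ->] := sin_MVT y y0.
rewrite mulrC ler_wpM2r// leNgt ltr_cos ?in_itv/= -?leNgt//; first exact/andP.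
by rewrite c0 (le_trans cy).
Qed.

(* cot(u/2)/2 - 1/u is bounded on ]0, pi] since, with y = u/2,
   0 <= sin y - y cos y <= y (1 - cos^2 y). *)
Lemma dirichlet_approx n u : 0 < u <= pi ->
  `|dirichlet n u - sin (n%:R * u) / u| <= 1.
Proof.
move=> /andP[u0 upi]; have pi0 := pi_gt0 R.
set y := u / 2; have y0 : 0 < y by rewrite divr_gt0.
have ypi : y <= pi / 2 by rewrite ler_pdivrMr// divfK.
have sy : 0 < sin y by apply: sin_gt0_pi; rewrite y0/=; lra.
have cy : 0 <= cos y by apply: cos_ge0_pihalf; lra.
have h1 : y * cos y <= sin y by apply: mul_cos_le_sin; lra.
have h2 : sin y <= y by apply: sin_le_id; lra.
have cy1 := cos_le1 y; have csy := cos2Dsin2 y.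
have h3 : sin y - y * cos y <= y * sin y.
  have : 0 <= sin y * (1 - sin y) by rewrite mulr_ge0 ?subr_ge0 ?sin_le1// ltW.
  nra.
(* Expanding sin(n u + y) separates the cotangent part from cos(n u)/2; each of the two summands is
   at most 1/2 in absolute value. *)
have E : dirichlet n u - sin (n%:R * u) / u =
  sin (n%:R * u) * ((y * cos y - sin y) / (2 * y * sin y)) + cos (n%:R * u) / 2.
  have -> : dirichlet n u = sin (n%:R * u + y) / (2 * sin y).
    by rewrite -dirichlet_sin mulfK// mulf_neq0// gt_eqF.
  have -> : u = 2 * y by rewrite /y mulrC divfK.
  by rewrite sinD; field; rewrite !gt_eqF.
rewrite E; apply: (le_trans (ler_normD _ _)).
apply: (@le_trans _ _ (2^-1 + 2^-1)); last lra.
apply: lerD; rewrite normrM.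
- rewrite -[leRHS]mul1r ler_pM ?sin_max//.
  rewrite normrM normfV [X in _ / X]gtr0_norm ?mulr_gt0//.
  rewrite ler_pdivrMr ?mulr_gt0// ler_norml; nra.
- by rewrite normfV [`|2|]ger0_norm// ler_piMl// cos_max.
Qed.

End DirichletKernel.

(** * Integral form of the partial sums, and recentring of the window at [x] *)

Section Localization.
Context {R : realType}.
Implicit Types (f g h : R -> R) (u v w x y t l c p q M : R) (n k : nat).

Lemma le_lint_seg u v p q h : p <= u -> u <= v -> v <= q -> seg_integrable p q h ->
  (forall t, p <= t <= q -> 0 <= h t) -> lint u v h <= lint p q h.
Proof.
move=> pu uv vq ih h0.
rewrite (lint_split p u q)//; last exact: le_trans vq.
rewrite (lint_split u v q)//; last by apply: seg_integrableS ih.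
rewrite addrCA lerDl addr_ge0//; apply: lint_ge0 => t /andP[ut tv]; apply: h0; lra.
Qed.

Lemma continuous_measurable_seg u v h : continuous h -> measurable_fun `[u, v] h.
Proof. by move=> ch; apply: measurable_funTS; exact: continuous_measurable_fun. Qed.

Lemma continuous_affine_comp (F : R -> R) x c l : continuous F ->
  continuous (fun t => F (c * (t - x) / l)).
Proof.
move=> cF t.
apply: (@continuous_comp _ _ _ (fun t => c * (t - x) / l) F); last exact: cF.
apply: cvgM; last exact: cvg_cst.
apply: cvgM; first exact: cvg_cst.
by apply: cvgB; [exact: cvg_id|exact: cvg_cst].
Qed.

Lemma seg_integrable_dirichlet u v n x l g : seg_integrable u v g ->
  seg_integrable u v (fun t => g t * dirichlet n (pi * (t - x) / l)).
Proof.
move=> ig; apply: (seg_integrableM _ _ (2^-1 + n%:R)) => //.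
  apply: continuous_measurable_seg; apply: continuous_affine_comp.
  exact: continuous_dirichlet.
by move=> t _; exact: norm_dirichlet_le.
Qed.

Lemma seg_integrable_cos u v k x l g : seg_integrable u v g ->
  seg_integrable u v (fun t => g t * cos (k%:R * (pi * (t - x) / l))).
Proof.
move=> ig; apply: (seg_integrableM _ _ 1) => //.
  apply: continuous_measurable_seg.
  have := @continuous_affine_comp (fun u => cos (k%:R * u)) x pi l; apply.
  move=> t; apply: (@continuous_comp _ _ _ (fun u => k%:R * u) cos).
    exact: mulrl_continuous.
  exact: continuous_cos.
by move=> t _; exact: cos_max.
Qed.

Lemma seg_integrable_sin u v k x l g : seg_integrable u v g ->
  seg_integrable u v (fun t => g t * sin (k%:R * (pi * (t - x) / l))).
Proof.
move=> ig; apply: (seg_integrableM _ _ 1) => //.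
  apply: continuous_measurable_seg.
  have := @continuous_affine_comp (fun u => sin (k%:R * u)) x pi l; apply.
  move=> t; apply: (@continuous_comp _ _ _ (fun u => k%:R * u) sin).
    exact: mulrl_continuous.
  exact: continuous_sin.
by move=> t _; exact: sin_max.
Qed.

(** Induction on [n]: by the subtraction formula for cosine, each new harmonic is the integral of
    [f] against one new cosine of the kernel. *)
Lemma partial_sum_dirichlet f n l x : seg_integrable (- l) l f ->
  partial_sum f n l x =
  l^-1 * lint (- l) l (fun t => f t * dirichlet n (pi * (t - x) / l)).
Proof.
move=> fi; elim: n => [|n IH].
  rewrite /partial_sum big_geq// addr0 /coef_a -mulrA; congr (_ * _).
  rewrite mulrC -lintZl; last first.
    have := seg_integrable_cos _ _ 0 0 l f fi.
    by congr seg_integrable; apply/funext => t; rewrite mul0r mulr0 !mul0r.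
  apply: eq_lint => t _; rewrite mulr0 !mul0r cos0 mulr1 /dirichlet big_geq//.
  by rewrite addr0 mulrC.
have -> : partial_sum f n.+1 l x = partial_sum f n l x +
    (coef_a f l n.+1 * cos (pi * n.+1%:R * x / l) +
     coef_b f l n.+1 * sin (pi * n.+1%:R * x / l)).
  by rewrite /partial_sum big_nat_recr//= addrA.
have E t : pi * n.+1%:R * t / l = n.+1%:R * (pi * (t - 0) / l).
  by rewrite subr0; ring.
have ic : seg_integrable (- l) l (fun t => f t * cos (pi * n.+1%:R * t / l)).
  have := seg_integrable_cos _ _ n.+1 0 l f fi.
  by congr seg_integrable; apply/funext => t; rewrite E.
have is' : seg_integrable (- l) l (fun t => f t * sin (pi * n.+1%:R * t / l)).
  have := seg_integrable_sin _ _ n.+1 0 l f fi.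
  by congr seg_integrable; apply/funext => t; rewrite E.
rewrite IH /coef_a /coef_b -!mulrA -!mulrDr; congr (_ * _).
rewrite ![_ * (_ / l)]mulrA ![lint _ _ _ * _]mulrC -!lintZl//.
rewrite -!lintD//; try exact: seg_integrableZl; last first.
- by apply: seg_integrableD; exact: seg_integrableZl.
- exact: seg_integrable_dirichlet.
apply: eq_lint => t _; rewrite dirichletS.
have -> : n.+1%:R * (pi * (t - x) / l) = pi * n.+1%:R * t / l - pi * (n.+1%:R * x) / l.
  by ring.
rewrite cosB; ring.
Qed.

(** No antiderivative is used: a shift by half a period flips the sign of the integrand, but by
    periodicity leaves the integral over [-l, l] unchanged, so the integral is its own opposite. *)
Lemma lint_cos_period k x l : 0 < l ->
  lint (- l) l (fun t => cos (k.+1%:R * (pi * (t - x) / l))) = 0.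
Proof.
move=> l0; set q := (fun t => _).
have iq u v : seg_integrable u v q.
  have := seg_integrable_cos u v k.+1 x l (fun=> 1) (seg_integrable_cst u v 1).
  by congr seg_integrable; apply/funext => t; rewrite mul1r.
(* Half a period: the phase advances by exactly [pi] under [t |-> t + c]. *)
pose c := l / k.+1%:R.
have k0 : 0 < k.+1%:R :> R by rewrite ltr0n.
have qc t : q (t + c) = - q t.
  rewrite /q -cosDpi; congr cos; rewrite /c; field.
  by rewrite !gt_eqF.
have q2 t : q (t + 2 * l) = q t.
  rewrite /q -[RHS](periodicn (@cosD2pi R) k.+1); congr cos.
  rewrite -mulr_natr -[pi *+ 2]mulr_natr; field.
  by rewrite gt_eqF.
have c0 : 0 < c by rewrite divr_gt0.
have cl : c <= l by rewrite ler_pdivrMr// ler_peMr ?ler1n// ltW.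
have : lint (- l) l (fun t => q (t + c)) = - lint (- l) l q.
  rewrite -[RHS]mulN1r -lintZl//; apply: eq_lint => t _; by rewrite qc mulN1r.
rewrite lint_shift// (lint_split (- l + c) l)//; [|lra|lra].
(* The piece pushed beyond [l] is brought back by the period [2 * l]. *)
have -> : lint l (l + c) q = lint (- l) (- l + c) q.
  have -> : lint (- l) (- l + c) q = lint (- l) (- l + c) (fun t => q (t + 2 * l)).
    by apply: eq_lint => t _; rewrite q2.
  have E1 : - l + 2 * l = l by ring.
  have E2 : - l + c + 2 * l = l + c by ring.
  by rewrite lint_shift// E1 E2.
rewrite addrC -(lint_split (- l) (- l + c) l)//; lra.
Qed.

Lemma lint_dirichlet n x l : 0 < l ->
  l^-1 * lint (- l) l (fun t => dirichlet n (pi * (t - x) / l)) = 1.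
Proof.
move=> l0; elim: n => [|n IH].
  have -> : (fun t => dirichlet 0 (pi * (t - x) / l)) = fun=> 2^-1.
    by apply/funext => t; rewrite /dirichlet big_geq// addr0.
  by rewrite lint_cst; [field; rewrite gt_eqF|lra].
rewrite -[RHS]IH; congr (_ * _).
have -> : (fun t => dirichlet n.+1 (pi * (t - x) / l)) =
    (fun t => dirichlet n (pi * (t - x) / l) + cos (n.+1%:R * (pi * (t - x) / l))).
  by apply/funext => t; rewrite dirichletS.
have i1 := seg_integrable_cst (- l) l 1.
rewrite lintD ?lint_cos_period ?addr0//.
- have := seg_integrable_dirichlet _ _ n x l _ i1.
  by congr seg_integrable; apply/funext => t; rewrite mul1r.
- have := seg_integrable_cos _ _ n.+1 x l _ i1.
  by congr seg_integrable; apply/funext => t; rewrite mul1r.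
Qed.

(** The kernel has total mass 1 by [lint_dirichlet], so the constant [c] can be moved under the
    integral. *)
Lemma partial_sumB f n l x c : 0 < l -> seg_integrable (- l) l f ->
  partial_sum f n l x - c =
  l^-1 * lint (- l) l (fun t => (f t - c) * dirichlet n (pi * (t - x) / l)).
Proof.
move=> l0 fi; rewrite partial_sum_dirichlet//.
rewrite [X in _ - X](_ : c =
  l^-1 * lint (- l) l (fun t => c * dirichlet n (pi * (t - x) / l))); last first.
  rewrite lintZl; first by rewrite mulrCA lint_dirichlet// mulr1.
  have := seg_integrable_dirichlet _ _ n x l _ (seg_integrable_cst (- l) l 1).
  by congr seg_integrable; apply/funext => t; rewrite mul1r.
rewrite -mulrBr -lintB; last 2 first.
- exact: seg_integrable_dirichlet.
- exact/seg_integrable_dirichlet/seg_integrable_cst.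
by congr (_ * _); apply: eq_lint => t _; rewrite mulrBl.
Qed.

Lemma seg_integrable_reflect f x u v : (forall u v, seg_integrable u v f) ->
  seg_integrable u v (fun t => f (x - t)).
Proof.
move=> fi; have := @seg_integrable_opp _ u v (fun s => f (s + x)).
have -> : (fun t => f (- t + x)) = (fun t => f (x - t)).
  by apply/funext => t; rewrite addrC.
by apply; exact: seg_integrable_shift.
Qed.

Lemma seg_integrable_phi f x u v : (forall u v, seg_integrable u v f) ->
  seg_integrable u v (phi f x).
Proof.
move=> fi; apply: seg_integrableB; last exact: seg_integrable_cst.
apply: seg_integrableD; last exact: seg_integrable_reflect.
have -> : (fun t => f (x + t)) = (fun t => f (t + x)).
  by apply/funext => t; rewrite addrC.
exact: seg_integrable_shift.
Qed.

(** After centring at [x], the left half is folded onto the right one by reflection; evenness of the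
    kernel makes the two values of [f] combine into [phi]. *)
Lemma lint_window f n l x : 0 < l -> (forall u v, seg_integrable u v f) ->
  lint (- l + x) (l + x) (fun t => (f t - f x) * dirichlet n (pi * (t - x) / l)) =
  lint 0 l (fun t => phi f x t * dirichlet n (pi * t / l)).
Proof.
move=> l0 fi; set G := (fun t => _).
have iG u v : seg_integrable u v G.
  by apply: seg_integrable_dirichlet; apply: seg_integrableB => //; exact: seg_integrable_cst.
have iH u v : seg_integrable u v (fun t => G (t + x)) by exact: seg_integrable_shift.
rewrite -lint_shift// (lint_split (- l) 0 l)//; [|lra|lra].
rewrite -[X in lint (- l) X]oppr0 -lint_opp; last by rewrite oppr0.
rewrite -lintD//; last first.
  by apply: (@seg_integrable_opp _ _ _ (fun t => G (t + x))).
apply: eq_lint => t _; rewrite /G /phi !addrK.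
have -> : pi * - t / l = - (pi * t / l) by rewrite mulrN mulNr.
by rewrite dirichletN [- t + x]addrC [t + x]addrC; ring.
Qed.

(** These conditions place |t - x| between l/2 and 3l/2, so the argument of the kernel lies in the
    range of [norm_dirichlet_le1]. *)
Lemma norm_dirichlet_far n l x M t : 0 < M -> `|x| <= M -> 4 * M <= l ->
  l - M <= `|t| <= l + M -> `|dirichlet n (pi * (t - x) / l)| <= 1.
Proof.
move=> M0 xM Ml /andP[t1 t2]; apply: norm_dirichlet_le1.
have l0 : 0 < l by lra.
have pi0 := pi_gt0 R.
rewrite !normrM normfV (gtr0_norm l0) (gtr0_norm pi0).
rewrite ler_pdivlMr// ler_pdivrMr//.
have a1 : `|t| - `|x| <= `|t - x| by exact: lerB_dist.
have a2 : `|t - x| <= `|t| + `|x| by exact: ler_normB.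
have b1 : l / 2 <= `|t - x| by lra.
have b2 : `|t - x| <= l + l / 2 by lra.
by apply/andP; split; nra.
Qed.

(** The windows [-l, l] and [x - l, x + l] share [-l + M, l - M], whose contribution cancels. Each
    leaves one end piece in either band of radius [M] about [l] and [-l], which gives the factor
    2. *)
Lemma partial_sum_localize f n l x M : (forall u v, seg_integrable u v f) ->
  0 < M -> `|x| <= M -> 4 * M <= l ->
  `|partial_sum f n l x - f x -
    l^-1 * lint 0 l (fun t => phi f x t * dirichlet n (pi * t / l))| <=
  l^-1 * (2 * (lint (l - M) (l + M) (fun t => `|f t - f x|) +
               lint (- l - M) (- l + M) (fun t => `|f t - f x|))).
Proof.
move=> fi M0 xM Ml; have l0 : 0 < l by lra.
rewrite partial_sumB// -lint_window//; set G := (fun t => _).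
have iG u v : seg_integrable u v G.
  by apply: seg_integrable_dirichlet; apply: seg_integrableB => //; exact: seg_integrable_cst.
have ig u v : seg_integrable u v (fun t => `|f t - f x|).
  by apply: seg_integrable_norm; apply: seg_integrableB => //; exact: seg_integrable_cst.
have /andP[x1 x2] : - M <= x <= M by rewrite -ler_norml.
have far p q u v : p <= u -> u <= v -> v <= q ->
    (forall t, p <= t <= q -> l - M <= `|t| <= l + M) ->
    `|lint u v G| <= lint p q (fun t => `|f t - f x|).
  move=> pu uv vq far; apply: (@le_trans _ _ (lint u v (fun t => `|f t - f x|))).
    apply: ler_norm_lint => // t /andP[ut tv]; rewrite normrM ler_piMr//.
    by apply: (norm_dirichlet_far _ _ _ M) => //; apply: far; lra.
  by apply: le_lint_seg.
have farR t : l - M <= t <= l + M -> l - M <= `|t| <= l + M.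
  by move=> /andP[? ?]; rewrite ger0_norm; lra.
have farL t : - l - M <= t <= - l + M -> l - M <= `|t| <= l + M.
  by move=> /andP[? ?]; rewrite ler0_norm; lra.
rewrite -mulrBr normrM normfV (gtr0_norm l0) ler_wpM2l ?invr_ge0 ?(ltW l0)// ler_norml.
rewrite (lint_split (- l) (- l + M) l)//; [|lra|lra].
rewrite (lint_split (- l + M) (l - M) l)//; [|lra|lra].
rewrite (lint_split (- l + x) (- l + M) (l + x))//; [|lra|lra].
rewrite (lint_split (- l + M) (l - M) (l + x))//; [|lra|lra].
have F1 : `|lint (- l) (- l + M) G| <= lint (- l - M) (- l + M) (fun t => `|f t - f x|).
  by apply: far => //; lra.
have F2 : `|lint (- l + x) (- l + M) G| <= lint (- l - M) (- l + M) (fun t => `|f t - f x|).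
  by apply: far => //; lra.
have F3 : `|lint (l - M) l G| <= lint (l - M) (l + M) (fun t => `|f t - f x|).
  by apply: far => //; lra.
have F4 : `|lint (l - M) (l + x) G| <= lint (l - M) (l + M) (fun t => `|f t - f x|).
  by apply: far => //; lra.
move: F1 F2 F3 F4; rewrite !ler_norml.
move: (lint (- l) _ G) (lint (- l + x) _ G) (lint (- l + M) _ G) (lint (l - M) l G)
  (lint (l - M) (l + x) G) => L1 L2 L3 L4 L5.
move: (lint (- l - M) _ _) (lint (l - M) _ _) => L6 L7.
by clear => *; lra.
Qed.

End Localization.

(** * Bounds for the Dirichlet integral, and convergence *)

Section MainEstimate.
Context {R : realType}.
Implicit Types (f g h p : R -> R) (u v w x y t l c d e C M : R) (n k m : nat).

Lemma measurable_inv_seg u v : 0 < u -> measurable_fun `[u, v] (fun t => t^-1).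
Proof.
move=> u0; apply: subspace_continuous_measurable_fun; first exact: measurable_itv.
apply: continuous_in_subspaceT => t; rewrite inE/= in_itv/= => /andP[ut _].
by apply: inv_continuous; rewrite gt_eqF//; lra.
Qed.

Lemma seg_integrable_div u v h : 0 < u -> seg_integrable u v h ->
  seg_integrable u v (fun t => h t / t).
Proof.
move=> u0 ih; apply: (seg_integrableM _ _ u^-1) => //.
  exact: measurable_inv_seg.
move=> t /andP[ut _]; rewrite ger0_norm ?invr_ge0; last lra.
by rewrite lef_pV2 ?posrE//; lra.
Qed.

Lemma lint_div_le u v h : 0 < u -> u <= v -> seg_integrable u v h ->
  (forall t, u <= t <= v -> 0 <= h t) ->
  lint u v (fun t => h t / t) <= u^-1 * lint u v h.
Proof.
move=> u0 uv ih h0; rewrite -lintZl//; apply: le_lint.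
- exact: seg_integrable_div.
- exact: seg_integrableZl.
- move=> t ut; rewrite mulrC ler_wpM2r ?h0//.
  by rewrite lef_pV2 ?posrE//; lra.
Qed.

(** One dyadic block: 1/t^2 <= 1/u^2 there and the mass is at most 2 C u. The square is written as a
    double division so that [lint_div_le] applies twice. *)
Lemma lint_div_sqr_le2 h u v C : 0 < u -> u <= v -> v <= 2 * u ->
  (forall u v, seg_integrable u v h) -> (forall t, 0 <= h t) -> 0 <= C ->
  lint 0 v h <= C * v -> lint u v (fun t => h t / t / t) <= 2 * C / u.
Proof.
move=> u0 uv v2 ih h0 C0 hC; have ihw := seg_integrable_div u v h u0 (ih u v).
apply: (le_trans (lint_div_le _ _ _ u0 uv ihw _)).
  by move=> t /andP[ut _]; rewrite divr_ge0//; lra.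
rewrite mulrC ler_wpM2r ?invr_ge0 ?(ltW u0)//.
apply: (le_trans (lint_div_le _ _ _ u0 uv (ih u v) _)) => //.
rewrite ler_pdivrMl//; apply: (@le_trans _ _ (lint 0 v h)).
  by apply: le_lint_seg => //; exact: ltW.
by apply: (le_trans hC); nra.
Qed.

(** Peeling off the block [u, 2u] costs 2C/u, and the rest starts at 2u. The constant 4 closes the
    induction since 2C/u + 4C/(2u) = 4C/u; [m] only counts blocks. *)
Lemma lint_div_sqr_le m h u v C : 0 < u -> u <= v -> v <= 2 ^+ m * u ->
  (forall u v, seg_integrable u v h) -> (forall t, 0 <= h t) -> 0 <= C ->
  (forall w, u <= w <= v -> lint 0 w h <= C * w) ->
  lint u v (fun t => h t / t / t) <= 4 * C / u.
Proof.
move=> + + + ih h0 C0; elim: m u => [|m IH] u u0 uv vm hC.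
  apply: (@le_trans _ _ (2 * C / u)).
    apply: lint_div_sqr_le2 => //; first by move: vm; rewrite expr0; lra.
    by apply: hC; rewrite uv lexx.
  by rewrite ler_wpM2r ?invr_ge0 ?(ltW u0)//; lra.
have [v2|v2] := leP v (2 * u).
  apply: (@le_trans _ _ (2 * C / u)).
    by apply: lint_div_sqr_le2 => //; apply: hC; rewrite uv lexx.
  by rewrite ler_wpM2r ?invr_ge0 ?(ltW u0)//; lra.
rewrite (lint_split u (2 * u) v); [|lra|lra|]; last first.
  by do 2 apply: seg_integrable_div => //.
have -> : 4 * C / u = 2 * C / u + 4 * C / (2 * u) by field; rewrite gt_eqF.
apply: lerD; first by apply: lint_div_sqr_le2 => //; [lra|apply: hC; lra].
apply: IH => //; [lra|lra|by rewrite mulrA -exprSr|].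
by move=> w /andP[w1 w2]; apply: hC; lra.
Qed.

(** * Estimates for a fixed function [p], later taken to be [phi f x], with [e] in the role of
    eta *)

Section Estimate.
Variables (p : R -> R) (n : nat) (l d H eps : R).
Hypothesis ip : forall u v, seg_integrable u v p.
Let P w := lint 0 w (fun t => `|p t|).
Let e := l / n%:R.
Hypothesis n0 : (0 < n)%N.
Hypothesis l0 : 0 < l.

Let e0 : 0 < e. Proof. by rewrite divr_gt0// ltr0n. Qed.
Let el : e <= l.
Proof. by rewrite ler_pdivrMr ?ltr0n// ler_peMr ?ler1n// ltW. Qed.
Let ian u v : seg_integrable u v (fun t => `|p t|).
Proof. exact: seg_integrable_norm. Qed.

(** As pi t / e = n pi t / l, [K / pi] is [p] times the leading term of the kernel divided by
    [l]. *)
Let K t := p t * sin (pi * t / e) / t.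

Let iK u v : 0 < u -> seg_integrable u v K.
Proof.
move=> u0; apply: seg_integrable_div => //.
have := seg_integrable_sin u v 1 0 e p (ip u v).
by congr seg_integrable; apply/funext => t; rewrite subr0 mul1r.
Qed.

(** On [0, e] the kernel is at most 2n, and 2n/l = 2/e. On [e, l] replacing it by its leading term
    costs at most 1, by [dirichlet_approx]. *)
Lemma kernel_estimate :
  `|l^-1 * lint 0 l (fun t => p t * dirichlet n (pi * t / l)) - pi^-1 * lint e l K| <=
  2 * e^-1 * P e + l^-1 * P l.
Proof.
have [? ? ?] : [/\ 0 < e, e <= l & 0 < l] by [].
have pi0 := pi_gt0 R.
have n1 : 1 <= n%:R :> R by rewrite ler1n.
have iD u v : seg_integrable u v (fun t => p t * dirichlet n (pi * t / l)).
  have := seg_integrable_dirichlet u v n 0 l p (ip u v).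
  by congr seg_integrable; apply/funext => t; rewrite subr0.
rewrite (lint_split 0 e l) ?(ltW e0)// mulrDr -addrA.
apply: (le_trans (ler_normD _ _)); apply: lerD.
  rewrite normrM normfV (gtr0_norm l0).
  have -> : 2 * e^-1 * P e = l^-1 * (2 * n%:R * P e).
    by rewrite /e; field; rewrite !gt_eqF// ltr0n.
  rewrite ler_wpM2l ?invr_ge0 ?(ltW l0)// -lintZl//.
  apply: ler_norm_lint => //; first exact: seg_integrableZl.
  move=> t _; rewrite normrM mulrC ler_wpM2r//.
  by apply: (le_trans (norm_dirichlet_le _ _)); lra.
have ie : seg_integrable e l (fun t => l^-1 * (p t * dirichlet n (pi * t / l))).
  exact: seg_integrableZl.
have iKe : seg_integrable e l (fun t => pi^-1 * K t).
  by apply: seg_integrableZl; exact: iK.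
rewrite -!lintZl//; last exact: iK.
rewrite -lintB//; apply: (@le_trans _ _ (lint e l (fun t => l^-1 * `|p t|))).
  apply: ler_norm_lint; [exact: seg_integrableB|exact: seg_integrableZl|].
  move=> t /andP[et tl]; have t0 : 0 < t by lra.
  have -> : l^-1 * (p t * dirichlet n (pi * t / l)) - pi^-1 * K t =
      l^-1 * p t * (dirichlet n (pi * t / l) - sin (n%:R * (pi * t / l)) / (pi * t / l)).
    rewrite /K; have -> : pi * t / e = n%:R * (pi * t / l).
      by rewrite /e; field; rewrite !gt_eqF// ltr0n.
    by move: pi0; move: (pi : R) => q q0; field; rewrite !gt_eqF.
  rewrite !normrM normfV (gtr0_norm l0) ler_piMr ?mulr_ge0 ?invr_ge0 ?(ltW l0)//.
  apply: dirichlet_approx; rewrite divr_gt0 ?mulr_gt0//= ler_pdivrMr//.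
  by rewrite ler_pM2l.
rewrite !lintZl// ler_wpM2l ?invr_ge0 ?(ltW l0)//.
by apply: le_lint_seg => //; exact: ltW.
Qed.

(** Translating by [e] changes the integral of [K] only by its parts over [e, 2e] and [l, l + e]. Up
    to these, twice the integral is that of K(t) + K(t + e), in which the sign change of the sine
    produces a difference. *)
Lemma shift_estimate :
  2 * `|lint e l K| <= e^-1 * P (2 * e) + l^-1 * P (l + e) +
    lint e l (fun t => `|p t - p (t + e)| / t) +
    2 * e * lint (2 * e) (l + e) (fun t => `|p t| / t / t).
Proof.
have [? ? ?] : [/\ 0 < e, e <= l & 0 < l] by [].
have Kle u v : 0 < u -> u <= v -> `|lint u v K| <= u^-1 * P v.
  move=> u0 uv; apply: (@le_trans _ _ (lint u v (fun t => `|p t| / t))).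
    apply: ler_norm_lint; [exact: iK|exact: seg_integrable_div|].
    move=> t /andP[ut _]; rewrite !normrM normfV (@ger0_norm _ t); last lra.
    rewrite ler_wpM2r ?invr_ge0//; first lra.
    by rewrite ler_piMr ?sin_max.
  apply: (le_trans (lint_div_le _ _ _ u0 uv (ian _ _) _)) => //.
  rewrite ler_wpM2l ?invr_ge0 ?(ltW u0)//.
  by apply: le_lint_seg => //; exact: ltW.
have iKs : seg_integrable e l (fun t => K (t + e)).
  by apply: seg_integrable_shift; apply: iK; lra.
have iKe : seg_integrable e l K by exact: iK.
have ee : e + e = 2 * e by rewrite mulr_natl mulr2n.
have Ks : lint e l (fun t => K (t + e)) = lint (2 * e) (l + e) K.
  by rewrite lint_shift ee//; apply: iK; lra.
have Ks2 : lint (2 * e) (l + e) K + lint e (2 * e) K = lint e l K + lint l (l + e) K.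
  have iKl : seg_integrable e (l + e) K by exact: iK.
  have S1 := lint_split e (2 * e) (l + e) K ltac:(lra) ltac:(lra) iKl.
  have S2 := lint_split e l (l + e) K ltac:(lra) ltac:(lra) iKl.
  by lra.
have B1 := Kle e (2 * e) e0 ltac:(lra).
have B2 := Kle l (l + e) l0 ltac:(lra).
have i1 : seg_integrable e l (fun t => `|p t - p (t + e)| / t).
  apply: seg_integrable_div => //; apply: seg_integrable_norm.
  by apply: seg_integrableB => //; exact: seg_integrable_shift.
have i2 u : 0 < u -> seg_integrable u (l + e) (fun t => `|p t| / t / t).
  by move=> u0; do 2 apply: seg_integrable_div => //.
have i3 : seg_integrable e l (fun t => `|p (t + e)| / (t + e) / (t + e)).
  by apply: (seg_integrable_shift e e l (fun t => `|p t| / t / t)); apply: i2; lra.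
have B3 : `|lint e l (fun t => K t + K (t + e))| <=
    lint e l (fun t => `|p t - p (t + e)| / t) +
    2 * e * lint (2 * e) (l + e) (fun t => `|p t| / t / t).
  have -> : lint (2 * e) (l + e) (fun t => `|p t| / t / t) =
      lint e l (fun t => `|p (t + e)| / (t + e) / (t + e)).
    rewrite (lint_shift e e l (fun t => `|p t| / t / t)); last by apply: i2; lra.
    by rewrite ee.
  rewrite -lintZl// -lintD//; last exact: seg_integrableZl.
  apply: ler_norm_lint; first exact: seg_integrableD.
    by apply: seg_integrableD => //; exact: seg_integrableZl.
  move=> t /andP[et tl]; have t0 : 0 < t by lra.
  have te0 : 0 < t + e by lra.
  have Sp : sin (pi * (t + e) / e) = - sin (pi * t / e).
    by rewrite -sinDpi; congr sin; field; rewrite gt_eqF.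
  (* With q = p(t + e): p(t)/t - q/(t + e) = (p(t) - q)/t + q (1/t - 1/(t + e)), and the last
     bracket is e/(t (t + e)). *)
  have -> : K t + K (t + e) = sin (pi * t / e) *
      ((p t - p (t + e)) / t + p (t + e) / (t + e) / t * e).
    by rewrite /K Sp; field; rewrite !gt_eqF.
  rewrite normrM; apply: (@le_trans _ _
      (1 * `|(p t - p (t + e)) / t + p (t + e) / (t + e) / t * e|)).
    by rewrite ler_wpM2r ?sin_max.
  rewrite mul1r; apply: (le_trans (ler_normD _ _)); apply: lerD.
    by rewrite normrM normfV (gtr0_norm t0).
  rewrite normrM (gtr0_norm e0) !normrM !normfV (gtr0_norm t0) (gtr0_norm te0).
  (* Since e <= t, 1/t <= 2/(t + e); this is the source of the factor 2. *)
  have -> : 2 * e * (`|p (t + e)| / (t + e) / (t + e)) =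
    `|p (t + e)| / (t + e) * (2 / (t + e)) * e by ring.
  rewrite ler_wpM2r ?(ltW e0)// ler_wpM2l ?mulr_ge0 ?invr_ge0 ?(ltW te0)//.
  by rewrite ler_pdivlMr// ler_pdivrMl//; lra.
suff : `|2 * lint e l K| <= e^-1 * P (2 * e) + l^-1 * P (l + e) +
    lint e l (fun t => `|p t - p (t + e)| / t) +
    2 * e * lint (2 * e) (l + e) (fun t => `|p t| / t / t).
  by rewrite normrM ger0_norm.
move: B1 B2 B3 Ks2; rewrite lintD// Ks !ler_norml.
move: (lint e l K) (lint l (l + e) K) (lint e (2 * e) K) (lint (2 * e) (l + e) K).
move: (e^-1 * _) (l^-1 * _) (lint e l _) (2 * e * _).
by move=> *; lra.
Qed.

(** * Consequences of quantitative forms of (A), below [d] and beyond [H], and of (B) *)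

Hypothesis eps0 : 0 < eps.
Hypothesis d0 : 0 < d.
Hypothesis dH : d <= H.
Hypothesis P0 : forall w, 0 < w <= d -> P w <= eps * w.
Hypothesis Poo : forall w, H <= w -> P w <= eps * w.
Hypothesis ed : 2 * e <= d.
Hypothesis edH : 8 * e * H <= d ^+ 2.
Hypothesis Hl : H <= l.

(** The range is cut at [d]. Below, the constant [eps] yields 4 eps. Above, the weaker constant eps
    H / d yields 8 e eps H / d^2, at most [eps] by [edH]. *)
Lemma sqr_estimate :
  2 * e * lint (2 * e) (l + e) (fun t => `|p t| / t / t) <= 5 * eps.
Proof.
have [? ? ?] : [/\ 0 < e, e <= l & 0 < l] by [].
have [? ? ? ? ?] : [/\ 0 < eps, 0 < d, d <= H, H <= l & 2 * e <= d] by [].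
have pow2 u v : 0 < u -> exists m, v <= 2 ^+ m * u.
  move=> u0; exists (Num.bound `|v / u|).
  rewrite -ler_pdivrMr//; apply: (le_trans (ler_norm _)).
  apply: (@le_trans _ _ (Num.bound `|v / u|)%:R); first exact/ltW/archi_boundP.
  by rewrite -natrX ler_nat ltnW// ltn_expl.
have i2 u v : 0 < u -> seg_integrable u v (fun t => `|p t| / t / t).
  by move=> u0; do 2 apply: seg_integrable_div => //.
rewrite (lint_split (2 * e) d (l + e))//; [|lra|by apply: i2; lra].
have H0 : 0 < H by lra.
have C0 : 0 <= eps * H / d by rewrite !mulr_ge0 ?invr_ge0 ?ltW.
have [m1 M1] := pow2 (2 * e) d ltac:(lra).
have [m2 M2] := pow2 d (l + e) d0.
have := lint_div_sqr_le m1 (fun t => `|p t|) (2 * e) d eps ltac:(lra) ed M1 ian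
  (fun t => normr_ge0 _) (ltW eps0) _.
have := lint_div_sqr_le m2 (fun t => `|p t|) d (l + e) (eps * H / d) d0 ltac:(lra) M2 ian
  (fun t => normr_ge0 _) C0 _.
move=> A2 A1.
have {}A1 : lint (2 * e) d (fun t => `|p t| / t / t) <= 4 * eps / (2 * e).
  by apply: A1 => w /andP[w1 w2]; apply: P0; lra.
have {}A2 : lint d (l + e) (fun t => `|p t| / t / t) <= 4 * (eps * H / d) / d.
  apply: A2 => w /andP[dw wl]; have [Hw|wH] := leP H w.
    apply: (le_trans (Poo w Hw)); rewrite ler_wpM2r//; first lra.
    by rewrite ler_pdivlMr// ler_pM2l.
  (* In the gap between [d] and [H] neither half of (A) applies; monotonicity gives P w <= P H <=
     eps H <= (eps H / d) w. *)
  apply: (@le_trans _ _ (P H)); first by apply: le_lint_seg => //; lra.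
  apply: (le_trans (Poo H (lexx _))); rewrite mulrAC ler_pdivlMr//.
  by rewrite ler_pM2l ?mulr_gt0.
have E1 : 2 * e * (4 * eps / (2 * e)) = 4 * eps by field; rewrite gt_eqF.
have E2 : 2 * e * (4 * (eps * H / d) / d) <= eps.
  have -> : 2 * e * (4 * (eps * H / d) / d) = eps * (8 * e * H / d ^+ 2).
    by field; rewrite gt_eqF.
  by rewrite ler_piMr ?(ltW eps0)// ler_pdivrMr ?exprn_gt0// mul1r.
rewrite mulrDr; apply: (@le_trans _ _ (4 * eps + eps)); last lra.
apply: lerD; first by rewrite -E1 ler_wpM2l//; lra.
by apply: le_trans E2; rewrite ler_wpM2l//; lra.
Qed.

Hypothesis B : lint e l (fun t => `|p t - p (t + e)| / t) <= eps.

(** The kernel error is 2 eps + eps. The integral of [K] is at most (2 + 2 + 1 + 5) eps / 2 = 5 eps,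
    hence at most 3 eps after division by pi >= 2. *)
Lemma dirichlet_integral_le :
  `|l^-1 * lint 0 l (fun t => p t * dirichlet n (pi * t / l))| <= 6 * eps.
Proof.
have [? ? ?] : [/\ 0 < e, e <= l & 0 < l] by [].
have [? ? ? ? ?] : [/\ 0 < eps, 0 < d, d <= H, H <= l & 2 * e <= d] by [].
have q1 : e^-1 * P e <= eps by rewrite ler_pdivrMl// mulrC P0//; lra.
have q2 : e^-1 * P (2 * e) <= 2 * eps.
  by rewrite ler_pdivrMl// (le_trans (P0 (2 * e) _))//; lra.
have q3 : l^-1 * P l <= eps by rewrite ler_pdivrMl// mulrC Poo.
have q4 : l^-1 * P (l + e) <= 2 * eps.
  rewrite ler_pdivrMl// (le_trans (Poo (l + e) _))//; first lra.
  by have := ltW eps0; nra.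
have B' := B; have J := shift_estimate; have S := sqr_estimate; have KE := kernel_estimate.
have J5 : `|lint e l K| <= 5 * eps.
  move: q2 q4 B' J S; move: `|_| (e^-1 * _) (l^-1 * _) (lint e l _) (2 * e * _).
  by move=> *; lra.
have J3 : `|pi^-1 * lint e l K| <= 3 * eps.
  rewrite normrM gtr0_norm ?invr_gt0 ?pi_gt0// ler_pdivrMl ?pi_gt0//.
  by apply: (le_trans J5); have := pi_ge2 R; have := ltW eps0; move: (pi : R) => *; nra.
rewrite -[X in `|X|](subrK (pi^-1 * lint e l K)).
apply: (le_trans (ler_normD _ _)); move: KE J3 q1 q3; rewrite -mulrA.
by move: `|_ - _| => a1; move: `|_| (e^-1 * _) (l^-1 * _) => *; lra.
Qed.

End Estimate.

(** * Tails of functions in E, and uniform convergence *)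

Lemma classE_seg_integrable f u v : classE f -> seg_integrable u v f.
Proof. by move=> [fi _ _]; apply: fi; exact: segment_compact. Qed.

(** Both bands come from the definition of E with width c = 2M and T = l - M. *)
Lemma classE_tails f M eps : classE f -> 0 < M -> 0 < eps -> exists N, [/\ 0 < N, M < N &
  forall l, N <= l -> lint (l - M) (l + M) (fun t => `|f t|) <= eps * l /\
    lint (- l - M) (- l + M) (fun t => `|f t|) <= eps * l].
Proof.
move=> [fi fR fL] M0 eps0.
have M2 : 0 < 2 * M by rewrite mulr_gt0.
have tail (F : R -> R) : T^-1 * F T @[T --> +oo] --> (0 : R) ->
    exists A : R, forall T, A < T -> 0 < T -> F T <= eps * T.
  move=> /cvgrPdist_le/(_ _ eps0)[A [_ hA]]; exists A => T AT T0.
  have := hA T AT; rewrite /= sub0r normrN => /(le_trans (ler_norm _)).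
  by rewrite ler_pdivrMl// mulrC.
have [A1 hA1] := tail _ (fR _ M2); have [A2 hA2] := tail _ (fL _ M2).
exists (`|A1| + `|A2| + 2 * M + 1).
have ? := ler_norm A1; have ? := ler_norm A2.
have ? := normr_ge0 A1; have ? := normr_ge0 A2.
split; [lra|lra|move=> l hl].
have E1 := hA1 (l - M) ltac:(lra) ltac:(lra).
have E2 := hA2 (l - M) ltac:(lra) ltac:(lra).
have F1 : l - M + 2 * M = l + M by ring.
have F2 : - (l - M) - 2 * M = - l - M by ring.
have F3 : - (l - M) = - l + M by ring.
rewrite F1 in E1; rewrite F2 F3 in E2.
by split; nra.
Qed.

(** Stated for any bounded set on which [f] is bounded, so that a singleton gives the pointwise
    claim and [a, b] the uniform one. *)
Lemma unif_partial_sum_cvg f (X : set R) : classE f ->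
  (exists M, forall x, X x -> `|x| <= M) -> (exists C, forall x, X x -> `|f x| <= C) ->
  unif_condA X f -> unif_condB X f ->
  unif_cvg_nl X (fun x n l => partial_sum f n l x) f.
Proof.
move=> fE [M0 XM0] [C0 XC0] [A0 Aoo] B eps eps0.
pose M := `|M0| + 1; pose C := `|C0| + 1.
have M_gt0 : 0 < M by rewrite ltr_wpDl.
have C_gt0 : 0 < C by rewrite ltr_wpDl.
have XM x : X x -> `|x| <= M by move=> /XM0 h; have := ler_norm M0; rewrite /M; lra.
have XC x : X x -> `|f x| <= C by move=> /XC0 h; have := ler_norm C0; rewrite /C; lra.
(* The Dirichlet integral will cost 6e and the localization 5e; 11 < 12 leaves the strict
   inequality. *)
pose e := eps / 12; have e0 : 0 < e by rewrite divr_gt0.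
have fi u v : seg_integrable u v f by exact: classE_seg_integrable.
have [d [d0 hd]] : exists d, 0 < d /\ forall w x, 0 < w <= d -> X x -> int_phi f x w <= e * w.
  have [d /= d0 hd] := A0 e e0.
  (* Halving turns the open neighbourhood of 0 into the closed bound [w <= d]. *)
  exists (d / 2); split; first by rewrite divr_gt0.
  move=> w x /andP[w0 wd] Xx; have := hd w.
  rewrite /= sub0r normrN (gtr0_norm w0) => /(_ ltac:(lra) w0 x Xx).
  exact/le_trans/ler_norm.
have [H0 hH0] : exists H, forall w x, H < w -> 0 < w -> X x -> int_phi f x w <= e * w.
  have [H [_ hH]] := Aoo e e0.
  exists H => w x Hw w0 Xx; have := hH w Hw x Xx.
  by rewrite (gtr0_norm w0); exact/le_trans/ler_norm.
pose H := `|H0| + d + 1.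
have dH : d <= H by rewrite /H; have := normr_ge0 H0; lra.
have hH w x : H <= w -> X x -> int_phi f x w <= e * w.
  by move=> Hw; apply: hH0; move: Hw; rewrite /H; have := ler_norm H0; have := normr_ge0 H0; lra.
have [NB [dB [NB0 dB0 hB]]] := B e e0.
have [NE [NE0 MNE hE]] := classE_tails f M e fE M_gt0 e0.
have H_gt0 : 0 < H by lra.
(* The summands serve (B), the tails, the large-scale half of (A), the localization, and 8 M C <= e
   l. *)
pose N := NB + NE + H + 4 * M + 8 * M * C / e.
have q0 : 0 < 8 * M * C / e by rewrite divr_gt0 ?mulr_gt0.
(* The three bounds on eta = l/n give (B), 2 eta <= d and 8 eta H <= d^2. *)
pose D := Num.min dB (Num.min (d / 2) (d ^+ 2 / (8 * H))).
have D0 : 0 < D by rewrite !lt_min dB0 !divr_gt0 ?exprn_gt0 ?mulr_gt0.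
have [? ? ? ?] : [/\ NB <= N, NE <= N, H <= N & 4 * M <= N].
  by move: q0; rewrite /N; move: (8 * M * C / e) => *; split; lra.
have QN : 8 * M * C / e <= N by rewrite /N lerDr; lra.
clearbody N.
exists N, D; split => //; first by lra.
move=> x n l Xx n0 Nn Nl; rewrite !le_min => /and3P[lB ld lH].
have l0 : 0 < l by lra.
have l1 : [/\ NB <= n%:R, NB <= l, NE <= l, H <= l & 4 * M <= l].
  by split; lra.
have l2 : 8 * M * C <= e * l.
  by rewrite [e * l]mulrC -ler_pdivrMr// (le_trans QN).
have [N1 N2 N3 N4 N5] := l1.
have lM : M <= l by lra.
have main : `|l^-1 * lint 0 l (fun t => phi f x t * dirichlet n (pi * t / l))| <= 6 * e.
  apply: (dirichlet_integral_le _ _ _ d H) => //.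
  - by move=> u v; exact: seg_integrable_phi.
  - by move=> w w0; exact: hd.
  - by move=> w Hw; exact: hH.
  - lra.
  - by move: lH; rewrite ler_pdivlMr ?mulr_gt0//; lra.
  - have := hB x n l Xx n0 N1 N2 lB; rewrite subr0 => /ltW; exact/le_trans/ler_norm.
have loc := partial_sum_localize f n l x M fi M_gt0 (XM x Xx) N5.
have tailB a b : a <= b -> b - a = 2 * M -> lint a b (fun t => `|f t|) <= e * l ->
    lint a b (fun t => `|f t - f x|) <= e * l + 2 * M * C.
  move=> ab ba h; apply: (@le_trans _ _ (lint a b (fun t => `|f t| + C))).
    apply: le_lint.
    + by apply: seg_integrable_norm; apply: seg_integrableB => //; exact: seg_integrable_cst.
    + by apply: seg_integrableD; [exact: seg_integrable_norm|exact: seg_integrable_cst].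
    + by move=> t _; apply: (le_trans (ler_normB _ _)); rewrite lerD2l XC.
  rewrite lintD; [|exact: seg_integrable_norm|exact: seg_integrable_cst].
  by rewrite lint_cst// ba; lra.
have [E1 E2] := hE l N3.
have width y : y - M <= y + M /\ y + M - (y - M) = 2 * M.
  by clear -M_gt0; split; lra.
have T1 := tailB _ _ (width l).1 (width l).2 E1.
have T2 := tailB _ _ (width (- l)).1 (width (- l)).2 E2.
(* Each band gives e l + 2 M C, so the error is at most 4e + 8 M C / l, which is at most 5e. *)
have {}loc : `|partial_sum f n l x - f x -
    l^-1 * lint 0 l (fun t => phi f x t * dirichlet n (pi * t / l))| <= 5 * e.
  apply: (le_trans loc); rewrite ler_pdivrMl//.
  move: T1 T2 l2; move: (lint _ _ _) (lint _ _ _) => A1 A2; clear => *; nra.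
have := ler_normD (partial_sum f n l x - f x -
    l^-1 * lint 0 l (fun t => phi f x t * dirichlet n (pi * t / l)))
  (l^-1 * lint 0 l (fun t => phi f x t * dirichlet n (pi * t / l))).
rewrite subrK => /le_lt_trans; apply.
move: loc main; have -> : eps = 12 * e by rewrite /e; field.
by move: `|_ - _| => a1; move: `|_| => a2; clear -e0 => *; lra.
Qed.

End MainEstimate.

Theorem theorem1 (R : realType) (a b : R) (f : R -> R) (hab : a <= b)
    (hf : classE f) :
  (forall x0 : R, x0 \in `[a, b] -> condA f x0 -> condB f x0 ->
     cvg_nl (fun n l => partial_sum f n l x0) (f x0))
  /\
  ([bounded f x | x in `[a, b]] ->
   unif_condA `[a, b] f -> unif_condB `[a, b] f ->
     unif_cvg_nl `[a, b] (fun x n l => partial_sum f n l x) f).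
Proof.
split=> [x _ [A0 Aoo] B|[C [_ fC]] A B].
(* Pointwise convergence is uniform convergence on a singleton. *)
- have cvgx : unif_cvg_nl [set x] (fun x n l => partial_sum f n l x) f.
    apply: unif_partial_sum_cvg => //.
    + by exists `|x| => _ ->.
    + by exists `|f x| => _ ->.
    + split=> eps eps0; [have := A0 eps eps0|have := Aoo eps eps0];
        by apply: filterS => h ? _ ->.
    + move=> eps eps0; have [N [d [N0 d0 h]]] := B eps eps0.
      by exists N, d; split => // _ n l ->; exact: h.
  move=> eps eps0; have [N [d [N0 d0 h]]] := cvgx eps eps0.
  by exists N, d; split => // n l; exact: h.
- apply: unif_partial_sum_cvg => //.
  + exists (`|a| + `|b|) => x /=; rewrite in_itv/= => /andP[ax xb].
    rewrite ler_norml; have := ler_norm (- a); have := ler_norm b.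
    by rewrite normrN; have := normr_ge0 a; have := normr_ge0 b; lra.
  + by exists (C + 1) => x /= Xx; apply: fC Xx; rewrite ltrDl.
Qed.
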